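(* Let $s\in(0,1]$, let $I\subset(0,\infty)$ be an interval, let $f:I\to\mathbb{R}$ be differentiable on $I^\circ$, let $a,b\in I$ with $a<b$, and suppose $f'\in L[a,b]$. Let $q\ge 1$. If $|f'|^q$ is harmonically $s$-convex on $[a,b]$, then for all $x\in[a,b]$, $$\left|f(x)-\frac{ab}{b-a}\int_a^b\frac{f(u)}{u^2}\,du\right|\le\frac{ab}{b-a}\left(\frac12\right)^{1-\frac1q}\Big\{(x-a)^2\big(\lambda_1(a,x,s,q,1)|f'(x)|^q+\lambda_2(a,x,s,q,1)|f'(a)|^q\big)^{1/q}+(b-x)^2\big(\lambda_3(b,x,s,q,1)|f'(x)|^q+\lambda_4(b,x,s,q,1)|f'(b)|^q\big)^{1/q}\Big\}.$$
   Context: For fixed $s\in(0,1]$ and a real interval $J\subset(0,\infty)$, a function $g:J\to\mathbb{R}$ is harmonically $s$-convex if $g\left(\frac{xy}{tx+(1-t)y}\right)\le t^s g(y)+(1-t)^s g(x)$ for all $x,y\in J$ and $t\in[0,1]$. $I^\circ$ is the interior of $I$; $L[a,b]$ denotes the Lebesgue integrable functions on $[a,b]$. Since $f'$ is used on all of $[a,b]$, $f$ is understood to be differentiable at every point of $[a,b]$ (one-sided at a point of $[a,b]$ that is an endpoint of $I$). The functions $\lambda_i$ are defined for $0<a\le x$ (for $\lambda_1,\lambda_2$) and $0<x\le b$ (for $\lambda_3,\lambda_4$) by $$\lambda_1(a,x,s,\vartheta,\rho)=\frac{\beta(\rho+s+1,1)}{x^{2\vartheta}}\,{}_2F_1\left(2\vartheta,\rho+s+1;\rho+s+2;1-\frac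 ax\right),$$ $$\lambda_2(a,x,s,\vartheta,\rho)=\frac{\beta(\rho+1,s+1)}{x^{2\vartheta}}\,{}_2F_1\left(2\vartheta,\rho+1;\rho+s+2;1-\frac ax\right),$$ $$\lambda_3(b,x,s,\vartheta,\rho)=\frac{\beta(1,\rho+s+1)}{b^{2\vartheta}}\,{}_2F_1\left(2\vartheta,1;\rho+s+2;1-\frac xb\right),$$ $$\lambda_4(b,x,s,\vartheta,\rho)=\frac{\beta(s+1,\rho+1)}{b^{2\vartheta}}\,{}_2F_1\left(2\vartheta,s+1;\rho+s+2;1-\frac xb\right).$$ Here $\beta(u,v)=\int_0^1t^{u-1}(1-t)^{v-1}\,dt$ for $u,v>0$ is the Euler Beta function, and ${}_2F_1(\alpha,\gamma;c;z)=\frac{1}{\beta(\gamma,c-\gamma)}\int_0^1t^{\gamma-1}(1-t)^{c-\gamma-1}(1-zt)^{-\alpha}\,dt$ for $c>\gamma>0$, $|z|<1$, is the hypergeometric function. *)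

(* Defs.v *)
From HB Require Import structures.
From mathcomp Require Import all_boot all_order all_algebra.
From mathcomp Require Import all_classical all_reals all_analysis.
Set Implicit Arguments.
Unset Strict Implicit.
Unset Printing Implicit Defensive.
Import Order.TTheory GRing.Theory Num.Theory.
Import numFieldNormedType.Exports.
Local Open Scope classical_set_scope.
Local Open Scope ring_scope.

Section derivative_within.
Context {R : realType}.
Implicit Types (I : set R) (f : R -> R) (x : R).

Definition diff_quotient f x : R -> R := fun y => (f y - f x) / (y - x).

(* Derivative of a function whose domain is the interval I: y tends to x with
   y <> x and y in I, so the limit is one-sided when x is an endpoint of I, and
   the values of f outside I are irrelevant. *)
Definition derivable_within I f x : Prop :=
  cvg (diff_quotient f x @ within I x^').

Definition derive_within I f x : R :=
  lim (diff_quotient f x @ within I x^').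

Lemma within_interior_dnbhs I x : I° x -> within I x^' = x^'.
Proof.
move=> Ix; apply/seteqP; split=> A; last exact: cvg_within.
rewrite /within /= => IA.
have : x^' I by exact: nbhs_dnbhs.
by apply: filterS2 IA => y; apply.
Qed.

Lemma diff_quotient_cvg_dnbhs f x :
  diff_quotient f x @ x^' = (fun h => h^-1 *: (f (h + x) - f x)) @ 0^'.
Proof.
have -> : (fun h => h^-1 *: (f (h + x) - f x)) =
          diff_quotient f x \o (fun h => h + x).
  by apply/funext => h /=; rewrite /diff_quotient addrK [RHS]mulrC.
apply/seteqP; split=> A.
- move=> /= /nbhs_ballP[e e0 hA]; apply/nbhs_ballP; exists e => //= h.
  rewrite /ball /= sub0r normrN => he h0; apply: hA.
    by rewrite /ball /= opprD addrCA subrr addr0 normrN.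
  by rewrite -subr_eq0 addrK.
- move=> /= /nbhs_ballP[e e0 hA]; apply/nbhs_ballP; exists e => //= y.
  rewrite /ball /= => he yx; rewrite /= -[y](subrK x); apply: hA.
    by rewrite /ball /= sub0r opprB.
  by rewrite subr_eq0.
Qed.

Lemma derive_within_interior I f x : I° x -> derive_within I f x = derive1 f x.
Proof.
by move=> Ix; rewrite /derive_within within_interior_dnbhs //
  diff_quotient_cvg_dnbhs.
Qed.

Lemma derivable_within_interior I f x :
  I° x -> derivable_within I f x <-> derivable f x 1.
Proof.
move=> Ix; rewrite /derivable_within within_interior_dnbhs //
  diff_quotient_cvg_dnbhs /derivable.
by under [X in _ <-> cvg (X @ _)]eq_fun do rewrite [_%:A]mulr1.
Qed.

End derivative_within.

Section harmonic_convexity.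
Context {R : realType}.

(* Meant for 0 < s <= 1 and J an interval of positive reals. *)
Definition harmonically_s_convex (s : R) (J : set R) (g : R -> R) : Prop :=
  forall x y t : R, J x -> J y -> 0 <= t <= 1 ->
    g (x * y / (t * x + (1 - t) * y)) <= t `^ s * g y + (1 - t) `^ s * g x.

End harmonic_convexity.

Section special_functions.
Context {R : realType}.
Local Notation mu := (@lebesgue_measure R).

(* The library's [beta_fun] only takes natural parameters. *)
Definition euler_beta (u v : R) : R :=
  \int[mu]_(t in `]0, 1[) (t `^ (u - 1) * (1 - t) `^ (v - 1)).

(* Euler's integral representation, for 0 < g < c and |z| < 1. *)
Definition hypergeometric2F1 (al g c z : R) : R :=
  (euler_beta g (c - g))^-1 *
  \int[mu]_(t in `]0, 1[)
    (t `^ (g - 1) * (1 - t) `^ (c - g - 1) * (1 - z * t) `^ (- al)).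

Definition lambda1 (a x s th rho : R) : R :=
  euler_beta (rho + s + 1) 1 / x `^ (2 * th) *
  hypergeometric2F1 (2 * th) (rho + s + 1) (rho + s + 2) (1 - a / x).

Definition lambda2 (a x s th rho : R) : R :=
  euler_beta (rho + 1) (s + 1) / x `^ (2 * th) *
  hypergeometric2F1 (2 * th) (rho + 1) (rho + s + 2) (1 - a / x).

Definition lambda3 (b x s th rho : R) : R :=
  euler_beta 1 (rho + s + 1) / b `^ (2 * th) *
  hypergeometric2F1 (2 * th) 1 (rho + s + 2) (1 - x / b).

Definition lambda4 (b x s th rho : R) : R :=
  euler_beta (s + 1) (rho + 1) / b `^ (2 * th) *
  hypergeometric2F1 (2 * th) (s + 1) (rho + s + 2) (1 - x / b).

End special_functions.

(* Main.v *)
(* For an endpoint c in {a, b} put phi t = c x / (t c + (1 - t) x), a path from c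
   to x, and let P be a primitive of f u / u ^ 2. The derivative of
   t (1/c - 1/x) f (phi t) - P (phi t) is (x - c)^2 t w t, up to sign, with
   w t = |f' (phi t)| / (t c + (1 - t) x)^2. Subtracting the total increments for
   c = a and c = b gives f x minus the weighted mean of f, up to the factor
   ab / (b - a). Since f' need not be continuous, w is not integrated: Young's
   inequality w <= k^(1-q) w^q / q + k (1 - 1/q) and harmonic s-convexity bound the
   derivative by a continuous function, whose integral is a combination of the
   Euler integrals defining the lambda_i, and the mean value theorem applies.
   Optimizing over k > 0 replaces Hoelder's inequality. *)
Require Import Defs.
From mathcomp Require Import all_boot all_order all_algebra.
From mathcomp Require Import all_classical all_reals all_analysis.
From mathcomp Require Import ring lra.
Set Implicit Arguments.
Unset Strict Implicit.
Unset Printing Implicit Defensive.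
Import Order.TTheory GRing.Theory Num.Theory.
Import numFieldNormedType.Exports.
Local Open Scope classical_set_scope.
Local Open Scope ring_scope.

(** * Primitives of continuous functions and bounds on increments *)

Section unit_interval_integrals.
Context {R : realType}.
Local Notation mu := (@lebesgue_measure R).
Implicit Types (a b : R) (f g k : R -> R).

Lemma within_continuous_integrable a b k :
  {within `[a, b], continuous k} -> mu.-integrable `[a, b] (EFin \o k).
Proof.
by move=> ck; apply: continuous_compact_integrable => //; exact: segment_compact.
Qed.

(** The indefinite integral from [a] is such a primitive: differentiable inside and continuous up to
    the endpoints, the form used by the mean value theorem. *)
Lemma continuous_primitive a b k : a < b -> {within `[a, b], continuous k} ->
  exists K : R -> R, [/\ {within `[a, b], continuous K},
    (forall t, t \in `]a, b[ -> is_derive t 1 K (k t)) &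
    K b - K a = \int[mu]_(t in `[a, b]) k t].
Proof.
move=> ab ck; have ik := within_continuous_integrable ck.
exists (fun u => \int[mu]_(t in `[a, u]) k t); split.
- by exact: (parameterized_integral_continuous (ltW ab) ik).
- move=> t /[dup] tab; rewrite in_itv/= => /andP[at_ tb].
  have ckt : {for t, continuous k}.
    by move: ck => /(continuous_within_itvP _ ab)[+ _ _]; exact.
  have [dKt dKE] := continuous_FTC1_closed tb ik at_ ckt.
  by apply: DeriveDef; [exact: dKt|rewrite -derive1E; exact: dKE].
- by rewrite set_itv1 Rintegral_set1 subr0.
Qed.

(** If [K] is a primitive of [k], then [K - f] has nonnegative derivative and does not decrease.
    Only the bound [k] is integrated, never [df]. *)
Lemma le_increment_integral a b f (df k : R -> R) : a < b ->
  {within `[a, b], continuous f} ->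
  (forall t, t \in `]a, b[ -> is_derive t 1 f (df t)) ->
  {within `[a, b], continuous k} ->
  (forall t, t \in `]a, b[ -> df t <= k t) ->
  f b - f a <= \int[mu]_(t in `[a, b]) k t.
Proof.
move=> ab cf fdf ck dfk; have [K [cK dK <-]] := continuous_primitive ab ck.
have dKf t : t \in `]a, b[ -> is_derive t 1 (K - f) (k t - df t).
  by move=> tab; apply: is_deriveB; [exact: dK|exact: fdf].
suff : (K - f) a <= (K - f) b by rewrite !fctE; lra.
apply: (@ger0_derive1_ndecr _ (K - f) a b) => //.
- by move=> t tab; have [] := dKf t tab.
- move=> t tab; have dt := dKf t tab.
  by rewrite derive1E derive_val subr_ge0; exact: dfk.
- by move=> u; apply: cvgB; [exact: cK|exact: cf].
- exact: (ltW ab).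
Qed.

Lemma norm_increment_le_integral a b f (df k : R -> R) : a < b ->
  {within `[a, b], continuous f} ->
  (forall t, t \in `]a, b[ -> is_derive t 1 f (df t)) ->
  {within `[a, b], continuous k} ->
  (forall t, t \in `]a, b[ -> `|df t| <= k t) ->
  `|f b - f a| <= \int[mu]_(t in `[a, b]) k t.
Proof.
move=> ab cf fdf ck dfk; rewrite ler_norml; apply/andP; split; last first.
  apply: (le_increment_integral ab cf fdf ck) => t tab.
  exact: le_trans (ler_norm _) (dfk t tab).
rewrite lerNl opprB addrC -[f a]opprK.
apply: (@le_increment_integral a b (- f) (fun t => - df t) k) => // [u|t tab|t tab].
- by apply: cvgN; exact: cf.
- by apply: is_deriveN; exact: fdf.
- by rewrite (le_trans _ (dfk t tab))// -normrN ler_norm.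
Qed.

(** By the mean value theorem the integral is [b - a] times a value of [k] at an interior point. *)
Lemma Rintegral_gt0 a b k : a < b -> {within `[a, b], continuous k} ->
  (forall t, t \in `]a, b[ -> 0 < k t) -> 0 < \int[mu]_(t in `[a, b]) k t.
Proof.
move=> ab ck k0; have [K [cK dK <-]] := continuous_primitive ab ck.
by have [c cab ->] := MVT ab dK cK; rewrite mulr_gt0 ?subr_gt0// k0.
Qed.

(** * Continuity of real powers and of the Euler kernels *)

Lemma powR_pos_continuous (e x : R) :
  0 < x -> {for x, continuous (fun u : R => u `^ e)}.
Proof.
move=> x0; apply: differentiable_continuous; apply/derivable1_diffP.
by apply: derivable_powR; rewrite in_itv/= andbT.
Qed.

(** The absolute value keeps the base nonnegative, so continuity at 0 holds from both sides. For
    [e = 0] the function is constantly 1, at 0 too. *)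
Lemma normr_powR_continuous (e : R) : 0 <= e ->
  continuous (fun u : R => `|u| `^ e).
Proof.
rewrite le_eqVlt => /predU1P[<- u|e0 u].
  by under eq_fun do rewrite powRr0; exact: cvg_cst.
have [->|u0] := eqVneq u 0; last first.
  apply: (@continuous_comp _ _ _ (fun v : R => `|v| : R) (fun v : R => v `^ e)).
    exact: norm_continuous.
  by apply: powR_pos_continuous; rewrite normr_gt0.
rewrite /continuous_at normr0 powR0 ?gt_eqF//.
apply/cvgrPdist_lt => d d0; near=> v.
rewrite sub0r normrN ger0_norm ?powR_ge0//.
have -> : d = (d `^ e^-1) `^ e.
  by rewrite -powRrM mulVf ?gt_eqF// powRr1// ltW.
apply: gt0_ltr_powR; rewrite ?nnegrE ?powR_ge0//.
near: v; apply/nbhs_ballP; exists (d `^ e^-1); first exact: powR_gt0.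
by move=> v; rewrite /ball/= sub0r normrN.
Unshelve. all: end_near. Qed.

Lemma eq_within_continuous (A : set R) f g :
  {in A, f =1 g} -> {within A, continuous f} -> {within A, continuous g}.
Proof. by move=> fg; exact: subspace_eq_continuous. Qed.

(** Common form of all the integrands: [p = 0] gives the Beta integrand, [x = 1] the hypergeometric
    one with argument [1 - c], and [euler_kernel 1 0 0 1 1] is [t] on [0, 1]. *)
Definition euler_kernel (e1 e2 p c x t : R) : R :=
  t `^ e1 * (1 - t) `^ e2 * (t * c + (1 - t) * x) `^ p.

Lemma segment_combo_gt0 (c x t : R) : 0 < c -> 0 < x -> t \in `[0, 1] ->
  0 < t * c + (1 - t) * x.
Proof.
move=> c0 x0; rewrite in_itv/= => /andP[t0 t1].
have [->|tn0] := eqVneq t 0; first by rewrite mul0r add0r subr0 mul1r.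
have tgt0 : 0 < t by rewrite lt_neqAle eq_sym tn0.
by rewrite ltr_pwDl ?mulr_gt0// mulr_ge0 ?subr_ge0// ltW.
Qed.

Lemma euler_kernel_ge0 (e1 e2 p c x t : R) : 0 <= euler_kernel e1 e2 p c x t.
Proof. by rewrite /euler_kernel !mulr_ge0 ?powR_ge0. Qed.

Lemma euler_kernel_gt0 (e1 e2 p c x t : R) : 0 < c -> 0 < x ->
  t \in `]0, 1[ -> 0 < euler_kernel e1 e2 p c x t.
Proof.
move=> c0 x0 t01; have A0 : 0 < t * c + (1 - t) * x.
  by apply: segment_combo_gt0 => //; exact: subset_itv_oo_cc.
move: t01; rewrite in_itv/= => /andP[t0 t1].
by rewrite /euler_kernel !mulr_gt0 ?powR_gt0 ?subr_gt0.
Qed.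

(** On [0, 1] the bases [t] and [1 - t] equal their absolute values, whose powers are continuous on
    the whole line. *)
Lemma within_continuous_euler_kernel (e1 e2 p c x : R) :
  0 <= e1 -> 0 <= e2 -> 0 < c -> 0 < x ->
  {within `[0, 1], continuous (euler_kernel e1 e2 p c x)}.
Proof.
move=> e10 e20 c0 x0.
apply: (@eq_within_continuous _
  (fun t => `|t| `^ e1 * `|1 - t| `^ e2 * (t * c + (1 - t) * x) `^ p)).
  move=> t; rewrite inE/= in_itv/= => /andP[t0 t1].
  by rewrite /euler_kernel (ger0_norm t0) ger0_norm ?subr_ge0.
apply: continuous_in_subspaceT => t; rewrite inE/= => t01.
have csub : {for t, continuous (fun u : R => 1 - u)}.
  by apply: cvgB; [exact: cvg_cst|exact: cvg_id].
apply: cvgM; first apply: cvgM.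
- exact: normr_powR_continuous.
- apply: (@continuous_comp _ _ _ (fun u : R => 1 - u) (fun u : R => `|u| `^ e2)) => //.
  exact: normr_powR_continuous.
- apply: (@continuous_comp _ _ _ (fun u : R => u * c + (1 - u) * x) (fun u : R => u `^ p)).
    apply: cvgD; apply: cvgM; [exact: cvg_id|exact: cvg_cst|exact: csub|exact: cvg_cst].
  by apply: powR_pos_continuous; exact: segment_combo_gt0.
Qed.

(** * Beta and hypergeometric integrals as kernel integrals over [0, 1] *)

Lemma Rintegral_oo_cc a b k : {within `[a, b], continuous k} ->
  \int[mu]_(t in `]a, b[) k t = \int[mu]_(t in `[a, b]) k t.
Proof.
move=> /within_continuous_integrable ik.
rewrite Rintegral_itv_bndo_bndc; last first.
  by apply: integrableS ik => //; exact: subset_itv_oo_cc.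
rewrite Rintegral_itv_obnd_cbnd//.
by apply: integrableS ik => //; exact: subset_itv_oc_cc.
Qed.

(** The substitution of [1 - t] for [t] exchanges the exponents and the two endpoints. *)
Lemma Rintegral_euler_kernel_onem (e1 e2 p c x : R) :
  0 <= e1 -> 0 <= e2 -> 0 < c -> 0 < x ->
  \int[mu]_(t in `[0, 1]) euler_kernel e1 e2 p c x t =
  \int[mu]_(t in `[0, 1]) euler_kernel e2 e1 p x c t.
Proof.
move=> e10 e20 c0 x0.
have r01 : 0 <= (1 : R) <= 1 by rewrite ler01 lexx.
have ck := within_continuous_euler_kernel (p := p) e10 e20 c0 x0.
rewrite (Rintegration_by_substitution_onem r01 ck).
rewrite [X in `[X, _]]subrr; apply: eq_Rintegral => t _.
rewrite /euler_kernel /unstable.onem subKr (mulrC (_ `^ e1)).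
by congr (_ * _ `^ _); ring.
Qed.

Lemma euler_beta_gt0 (u v : R) : 1 <= u -> 1 <= v -> 0 < euler_beta u v.
Proof.
move=> u1 v1; rewrite /euler_beta.
have ck := @within_continuous_euler_kernel (u - 1) (v - 1) 0 1 1.
have -> : (fun t : R => t `^ (u - 1) * (1 - t) `^ (v - 1)) =
    euler_kernel (u - 1) (v - 1) 0 1 1.
  by apply/funext => t; rewrite /euler_kernel powRr0 mulr1.
rewrite Rintegral_oo_cc; last by apply: ck; rewrite ?subr_ge0.
apply: Rintegral_gt0 => //; first by apply: ck; rewrite ?subr_ge0.
by move=> t t01; exact: euler_kernel_gt0.
Qed.

(** The Beta factor cancels the normalization of the hypergeometric function. The power of [x] is
    absorbed into the last factor, since [x * (1 - (1 - y / x) * t) = t * y + (1 - t) * x]. *)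
Lemma euler_beta_hypergeometric2F1 (al g h x y : R) :
  1 <= g -> 1 <= h -> 0 < x -> 0 < y ->
  euler_beta g h / x `^ al * hypergeometric2F1 al g (g + h) (1 - y / x) =
  \int[mu]_(t in `[0, 1]) euler_kernel (g - 1) (h - 1) (- al) y x t.
Proof.
move=> g1 h1 x0 y0; rewrite /hypergeometric2F1 addrAC subrr add0r.
have b0 := euler_beta_gt0 g1 h1.
rewrite mulrAC !mulrA mulfV ?gt_eqF// mul1r mulrC.
have ck : {within `[0, 1], continuous (euler_kernel (g - 1) (h - 1) (- al) y x)}.
  by apply: within_continuous_euler_kernel; rewrite ?subr_ge0.
rewrite -(Rintegral_oo_cc ck).
have ck' : {within `[0, 1], continuous
    (euler_kernel (g - 1) (h - 1) (- al) (y / x) 1)}.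
  by apply: within_continuous_euler_kernel; rewrite ?subr_ge0// divr_gt0.
have -> : (fun t : R => t `^ (g - 1) * (1 - t) `^ (h - 1) *
    (1 - (1 - y / x) * t) `^ (- al)) =
    euler_kernel (g - 1) (h - 1) (- al) (y / x) 1.
  by apply/funext => t; rewrite /euler_kernel; congr (_ * _ `^ _); ring.
rewrite -RintegralZl//; last first.
  apply: (integrableS _ _ _ (within_continuous_integrable ck')) => //.
  exact: subset_itv_oo_cc.
apply: eq_Rintegral => t; rewrite inE/= => t01.
rewrite /euler_kernel mulrCA; congr (_ * _).
have -> : t * y + (1 - t) * x = x * (t * (y / x) + (1 - t) * 1).
  by field; rewrite gt_eqF.
rewrite powRM ?(ltW x0)//; first by rewrite (powRN x).
apply: ltW; apply: segment_combo_gt0 => //; first by rewrite divr_gt0.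
exact: subset_itv_oo_cc.
Qed.

End unit_interval_integrals.

(** * Young's inequality and the estimate along the path from an endpoint *)

Section endpoint_estimate.
Context {R : realType}.
Local Notation mu := (@lebesgue_measure R).
Implicit Types (w k q : R).

(** The integrals of [t] and [1 - t] agree by reflection and add up to 1. This is the source of the
    factor [1 / 2] in the final bound. *)
Lemma Rintegral_euler_kernel_id :
  \int[mu]_(t in `[0, 1]) euler_kernel 1 0 0 1 1 t = 1 / 2.
Proof.
have ck1 : {within `[0, 1], continuous (@euler_kernel R 1 0 0 1 1)}.
  exact: within_continuous_euler_kernel.
have ck2 : {within `[0, 1], continuous (@euler_kernel R 0 1 0 1 1)}.
  exact: within_continuous_euler_kernel.
suff : \int[mu]_(t in `[0, 1]) euler_kernel 1 0 0 1 1 t +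
       \int[mu]_(t in `[0, 1]) euler_kernel 0 1 0 1 1 t = 1.
  by rewrite [X in _ + X]Rintegral_euler_kernel_onem// -mulr2n -[_ *+ 2]mulr_natr => h;
  apply: (@mulIf _ 2); rewrite ?pnatr_eq0// h divfK ?pnatr_eq0.
rewrite -RintegralD//; do ?exact: within_continuous_integrable.
transitivity (\int[mu]_(t in `[0, 1]) (1 : R)).
  apply: eq_Rintegral => t; rewrite inE/= in_itv/= => /andP[t0 t1].
  by rewrite /euler_kernel !powRr0 !powRr1 ?subr_ge0//; ring.
by rewrite Rintegral_cst//= lebesgue_measure_itv/= lte_fin ltr01 oppr0 adde0 mulr1.
Qed.

(** Young's inequality for [w] and [k]^ (q - 1)[with conjugate exponents]q[and]q / (q -
    1)[, multiplied by]k [^ (1 - q)]. For [q = 1] both sides equal [w]. *)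
Lemma weighted_young w k q : 0 <= w -> 0 < k -> 1 <= q ->
  w <= k `^ (1 - q) * w `^ q / q + k * (1 - 1 / q).
Proof.
move=> w0 k0; rewrite le_eqVlt => /predU1P[<-|q1].
  by rewrite subrr powRr0 powRr1// !divr1 subrr mulr0 addr0 mul1r.
have q0 : 0 < q by lra.
have qn0 : q != 0 by rewrite gt_eqF.
have q1n0 : q - 1 != 0 by rewrite subr_eq0 gt_eqF.
have kq : k `^ (1 - q) * k `^ (q - 1) = 1.
  rewrite -powRD; last by rewrite (gt_eqF k0) implybT.
  by rewrite (_ : 1 - q + (q - 1) = 0) ?powRr0//; ring.
have := @conjugate_powR R w (k `^ (q - 1)) q (q / (q - 1)) w0 (powR_ge0 _ _) q0.
rewrite divr_gt0 ?subr_gt0// => /(_ isT).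
have -> : q^-1 + (q / (q - 1))^-1 = 1 by field; rewrite qn0 q1n0.
move=> /(_ erefl).
rewrite -powRrM mulrCA mulfV// mulr1 => /(ler_wpM2l (powR_ge0 k (1 - q))).
rewrite mulrCA kq mulr1 => /le_trans; apply.
have -> : k `^ q = k `^ (q - 1) * k.
  by rewrite -[X in _ * X](powRr1 (ltW k0)) -powRD ?subrK// (gt_eqF k0) implybT.
rewrite mulrDr mulrA lerD2l !mulrA kq mul1r le_eqVlt; apply/orP; left; apply/eqP.
by field; rewrite qn0 q1n0.
Qed.

(** The right-hand side is the infimum over [k] of the bounds on [X]. *)
Lemma powR_young_inf (X L q : R) : 0 <= L -> 1 <= q ->
  (forall k, 0 < k -> X <= k `^ (1 - q) * L / q + k * (1 - 1 / q) / 2) ->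
  X <= (1 / 2) `^ (1 - 1 / q) * L `^ (1 / q).
Proof.
move=> L0 q1 hX; have q0 : 0 < q by lra.
have qn0 : q != 0 by rewrite gt_eqF.
move: L0; rewrite le_eqVlt => /predU1P[L0|L0].
  rewrite -L0 powR0 ?mulr0; last by rewrite mulf_neq0 ?invr_eq0 ?oner_eq0.
  (* For [L = 0] the choice of [k] below would be 0, so [k = e] is taken with [e] arbitrarily
     small. *)
  apply/ler_addgt0Pl => e e0; rewrite addr0.
  apply: (le_trans (hX _ e0)); rewrite -L0 mulr0 mul0r add0r -mulrA ler_piMr// ?ltW//.
  have : 0 < 1 / q by rewrite divr_gt0.
  by lra.
pose k := (2 * L) `^ (1 / q).
have k0 : 0 < k by rewrite powR_gt0// mulr_gt0.
apply: (le_trans (hX _ k0)).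
have kq : k `^ q = 2 * L by rewrite -powRrM div1r mulVf// powRr1// ltW// mulr_gt0.
have -> : k `^ (1 - q) = k / (2 * L).
  by rewrite powRB ?powRr1 ?kq ?ltW// (gt_eqF k0) implybT.
have -> : (1 / 2) `^ (1 - 1 / q) * L `^ (1 / q) = k / 2.
  rewrite /k powRM ?(ltW L0)// powRB; last by rewrite mulf_neq0 ?implybT// invr_eq0 pnatr_eq0.
  rewrite powRr1; last lra.
  have -> : (2 : R) `^ (1 / q) = ((1 / 2) `^ (1 / q))^-1.
    have V0 : ((1 / 2) `^ (1 / q) : R) != 0.
      by rewrite lt0r_neq0// powR_gt0// divr_gt0.
    apply: (mulIf V0); rewrite mulVf// -powRM//.
    by rewrite (_ : 2 * (1 / 2) = 1 :> R) ?powR1//; field.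
  by ring.
rewrite le_eqVlt; apply/orP; left; apply/eqP; field.
by rewrite qn0 gt_eqF.
Qed.

(** The path [phi] runs from [c] at 0 to [x] at 1, and the order of [c] and [x] is left open, so
    that one statement serves both ends of the interval. [m1] and [m2] stand for the values of
    |f'|^q at [x] and [c]. *)
Lemma harmonic_endpoint_estimate (f df P : R -> R) (c x s q m1 m2 : R)
    (phi := fun t : R => c * x / (t * c + (1 - t) * x)) :
  0 < c -> 0 < x -> x != c -> 0 <= s -> 1 <= q -> 0 <= m1 -> 0 <= m2 ->
  (forall t, t \in `[0, 1] -> {for phi t, continuous f}) ->
  (forall t, t \in `[0, 1] -> {for phi t, continuous P}) ->
  (forall t, t \in `]0, 1[ -> is_derive (phi t) 1 f (df (phi t))) ->
  (forall t, t \in `]0, 1[ -> is_derive (phi t) 1 P (f (phi t) / phi t ^+ 2)) ->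
  (forall t, t \in `]0, 1[ ->
    `|df (phi t)| `^ q <= t `^ s * m1 + (1 - t) `^ s * m2) ->
  `|(c^-1 - x^-1) * f x - (P x - P c)| <=
    (x - c) ^+ 2 * ((1 / 2) `^ (1 - 1 / q) *
    ((\int[mu]_(t in `[0, 1]) euler_kernel (s + 1) 0 (- (2 * q)) c x t) * m1 +
     (\int[mu]_(t in `[0, 1]) euler_kernel 1 s (- (2 * q)) c x t) * m2) `^ (1 / q)).
Proof.
move=> c0 x0 xc s0 q1 m10 m20 cf cP df_ dP hdf.
have cn0 : c != 0 by rewrite gt_eqF.
have xn0 : x != 0 by rewrite gt_eqF.
have q0 : 0 < q by lra.
have ck1 : {within `[0, 1], continuous (euler_kernel (s + 1) 0 (- (2 * q)) c x)}.
  by apply: within_continuous_euler_kernel => //; lra.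
have ck2 : {within `[0, 1], continuous (euler_kernel 1 s (- (2 * q)) c x)}.
  by apply: within_continuous_euler_kernel => //; lra.
have ck3 : {within `[0, 1], continuous (@euler_kernel R 1 0 0 1 1)}.
  exact: within_continuous_euler_kernel.
have ik1 := within_continuous_integrable ck1.
have ik2 := within_continuous_integrable ck2.
have ik3 := within_continuous_integrable ck3.
set I1 := Rintegral _ _ _; set I2 := Rintegral _ _ _.
have L0 : 0 <= I1 * m1 + I2 * m2.
  by rewrite addr_ge0// mulr_ge0//; apply: Rintegral_ge0 => t _;
    exact: euler_kernel_ge0.
have xc20 : 0 < (x - c) ^+ 2 by rewrite exprn_even_gt0//= subr_eq0.
(* From here on [k] is fixed, and only the Young bound for this [k] is to be shown. *)
rewrite -ler_pdivrMl//; apply: powR_young_inf => // k k0.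
rewrite ler_pdivrMl//.
pose A (t : R) : R := t * c + (1 - t) * x.
have A0 (t : R) : t \in `[0, 1] -> 0 < A t by exact: segment_combo_gt0.
have dphi (t : R) : t \in `[0, 1] -> is_derive t 1 phi (c * x * (x - c) / A t ^+ 2).
  move=> t01; have An0 : A t != 0 by rewrite gt_eqF// A0.
  have dA : is_derive t 1 A (c - x).
    by rewrite /A; apply: is_derive_eq; rewrite /GRing.scale/=; ring.
  have -> : phi = (fun t : R => c * x * (A t)^-1) by [].
  have dAV : is_derive t 1 (fun t : R => (A t)^-1) (- (A t) ^- 2 *: (c - x)).
    exact: is_deriveV.
  apply: is_derive_eq.
  by rewrite -[_ *: _]/(_ * _) -[_ *: _]/(_ * _); field.
(* Since 1 / [phi] is affine, phi' / phi^2 is the constant [c^-1 - x^-1]. In the derivative of [Psi]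
   the terms with [f] therefore cancel and only the one with [df] remains. *)
pose Psi (t : R) : R := t * (c^-1 - x^-1) * f (phi t) - P (phi t).
have phi0 : phi 0 = c by rewrite /phi; field.
have phi1 : phi 1 = x by rewrite /phi; field.
have <- : Psi 1 - Psi 0 = (c^-1 - x^-1) * f x - (P x - P c).
  by rewrite /Psi phi0 phi1; ring.
have dPsi (t : R) : t \in `]0, 1[ ->
    is_derive t 1 Psi ((x - c) ^+ 2 * t / A t ^+ 2 * df (phi t)).
  move=> t01; have t01' := subset_itv_oo_cc t01.
  have An0 : A t != 0 by rewrite gt_eqF// A0.
  have dp := dphi _ t01'.
  have d1 : is_derive t 1 (f \o phi) _ := is_derive1_comp (df_ _ t01) dp.
  have d2 : is_derive t 1 (P \o phi) _ := is_derive1_comp (dP _ t01) dp.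
  have -> : Psi = (fun t : R => t * (c^-1 - x^-1) * (f \o phi) t - (P \o phi) t) by [].
  apply: is_derive_eq.
  rewrite /GRing.scale/= /phi -/(A t).
  by field; rewrite An0 xn0 cn0.
have cPsi : {within `[0, 1], continuous Psi}.
  apply: continuous_in_subspaceT => t; rewrite inE/= => t01.
  have cphi : {for t, continuous phi}.
    apply: differentiable_continuous; apply/derivable1_diffP.
    by have [] := dphi _ t01.
  apply: cvgB; last by apply: (@continuous_comp _ _ _ phi P) => //; exact: cP.
  apply: cvgM; last by apply: (@continuous_comp _ _ _ phi f) => //; exact: cf.
  by apply: cvgM; [exact: cvg_id|exact: cvg_cst].
(* The majorant is [t] times the Young bound, with the [q]-th power replaced by its convexity bound.
   The factor [t] turns [t]^ s[into]t [^ (s + 1)]. *)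
pose M (t : R) : R := (x - c) ^+ 2 * (k `^ (1 - q) / q *
   (m1 * euler_kernel (s + 1) 0 (- (2 * q)) c x t +
    m2 * euler_kernel 1 s (- (2 * q)) c x t) +
   k * (1 - 1 / q) * euler_kernel 1 0 0 1 1 t).
have cZ (r : R) (h : R -> R) : {within `[0, 1], continuous h} ->
    {within `[0, 1], continuous (fun t => r * h t)}.
  by move=> ch t; apply: cvgM; [exact: cvg_cst|exact: ch].
have cD (h1 h2 : R -> R) : {within `[0, 1], continuous h1} ->
    {within `[0, 1], continuous h2} ->
    {within `[0, 1], continuous (fun t => h1 t + h2 t)}.
  by move=> ch1 ch2 t; apply: cvgD; [exact: ch1|exact: ch2].
have cM1 := cD _ _ (cZ m1 _ ck1) (cZ m2 _ ck2).
have cM2 := cZ (k `^ (1 - q) / q) _ cM1.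
have cM3 := cD _ _ cM2 (cZ (k * (1 - 1 / q)) _ ck3).
have cM : {within `[0, 1], continuous M} by exact: cZ.
have -> : (x - c) ^+ 2 * (k `^ (1 - q) * (I1 * m1 + I2 * m2) / q +
    k * (1 - 1 / q) / 2) = \int[mu]_(t in `[0, 1]) M t.
  rewrite /M RintegralZl//; last first.
    by apply: within_continuous_integrable; exact: cM3.
  congr (_ * _); rewrite RintegralD//; last 2 first.
  - exact: (within_continuous_integrable cM2).
  - exact: (within_continuous_integrable (cZ _ _ ck3)).
  rewrite !RintegralZl//; last exact: (within_continuous_integrable cM1).
  rewrite RintegralD//; last 2 first.
  - exact: (within_continuous_integrable (cZ _ _ ck1)).
  - exact: (within_continuous_integrable (cZ _ _ ck2)).
  rewrite !RintegralZl// Rintegral_euler_kernel_id -/I1 -/I2.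
  by field; rewrite gt_eqF.
apply: (norm_increment_le_integral ltr01 cPsi dPsi cM) => t t01.
have At0 : 0 < A t by apply: A0; exact: subset_itv_oo_cc.
have /andP[t0 t1] : 0 < t < 1 by move: t01; rewrite in_itv.
have [t0' t1'] : 0 <= t /\ 0 <= 1 - t by rewrite subr_ge0 !ltW.
have -> : `|(x - c) ^+ 2 * t / A t ^+ 2 * df (phi t)| =
    (x - c) ^+ 2 * (t * (`|df (phi t)| / A t ^+ 2)).
  rewrite normrM ger0_norm; first by ring.
  by rewrite divr_ge0 ?sqr_ge0// mulr_ge0 ?sqr_ge0.
rewrite /M ler_pM2l//.
set w := `|df (phi t)| / A t ^+ 2.
have w0 : 0 <= w by rewrite divr_ge0 ?sqr_ge0 ?normr_ge0.
(* The square of [A t] in the denominator of [w] produces the exponent [- (2 * q)]. *)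
have wq : w `^ q <= (t `^ s * m1 + (1 - t) `^ s * m2) * A t `^ (- (2 * q)).
  rewrite /w powRM ?invr_ge0 ?sqr_ge0//.
  have -> : (A t ^+ 2)^-1 `^ q = A t `^ (- (2 * q)).
    by rewrite -powR_invn ?ltW// -powRrM mulNr.
  by rewrite ler_wpM2r ?powR_ge0// hdf.
apply: (le_trans (ler_wpM2l t0' (weighted_young w0 k0 q1))).
rewrite mulrDr; apply: lerD; last first.
  by rewrite /euler_kernel !powRr0 powRr1// !mulr1 mulrC.
rewrite mulrAC mulrCA ler_wpM2l//.
  by rewrite divr_ge0 ?powR_ge0// ltW.
apply: (le_trans (ler_wpM2l t0' wq)).
rewrite /euler_kernel -/(A t) powRr0 (powRr1 t0') mulr1 powRD; last first.
  by rewrite (gt_eqF t0) implybT.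
rewrite (powRr1 t0') le_eqVlt; apply/orP; left; apply/eqP.
by ring.
Qed.

End endpoint_estimate.

(** * Continuity relative to an interval, clamping, and the location of harmonic points *)

Section harmonic_points.
Context {R : realType}.
Local Notation mu := (@lebesgue_measure R).
Implicit Types (I : set R) (f : R -> R).

(** [f y] is [f x] plus the difference quotient times [y - x], a convergent factor times one tending
    to 0. The point [x], missing from the punctured filter, is added at the end. *)
Lemma derivable_within_cvg I f (x : R) :
  derivable_within I f x -> f y @[y --> within I (nbhs x)] --> f x.
Proof.
rewrite /derivable_within => dfx.
have fE : f = (fun y => f x + diff_quotient f x y * (y - x)).
  apply/funext => y; have [->|yx] := eqVneq y x; first by rewrite subrr mulr0 addr0.
  by rewrite /diff_quotient divfK ?subr_eq0// subrKC.
have : f y @[y --> within I x^'] --> f x.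
  rewrite {1}fE -[X in _ --> X]addr0 -(mulr0 (lim (diff_quotient f x @ within I x^'))).
  apply: cvgD; first exact: cvg_cst.
  apply: cvgM; first exact: dfx.
  rewrite -(subrr x); apply: cvgB; last exact: cvg_cst.
  by move=> A xA; apply: cvg_within; exact: nbhs_dnbhs.
move=> /cvgrPdist_lt fx; apply/cvgrPdist_lt => e e0.
have fxe : \forall y \near x, y != x -> I y -> `|f x - f y| < e := fx e e0.
suff : \forall y \near x, I y -> `|f x - f y| < e by [].
apply: filterS fxe => y fy Iy.
by have [->|yx] := eqVneq y x; [rewrite subrr normr0|exact: fy].
Qed.

(* [f \o clamp a b] is continuous on the whole line and coincides with [f] on
   [a, b], so one-sided limits at the endpoints disappear. *)
Definition clamp (a b u : R) : R := Num.max a (Num.min u b).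

Lemma clamp_itv (a b u : R) : a <= b -> clamp a b u \in `[a, b].
Proof. by move=> ab; rewrite in_itv/= le_max lexx ge_max ab ge_min lexx orbT. Qed.

Lemma clamp_id (a b u : R) : u \in `[a, b] -> clamp a b u = u.
Proof. by rewrite in_itv/= => /andP[au ub]; rewrite /clamp min_l// max_r. Qed.

Lemma clamp_continuous (a b : R) : continuous (clamp a b).
Proof.
move=> u; apply: (@continuous_max _ _ (cst a) (fun v : R => Num.min v b)).
  exact: cvg_cst.
by apply: (@continuous_min _ _ id (cst b)); [exact: cvg_id|exact: cvg_cst].
Qed.

Lemma continuous_clamp_comp (a b : R) f : a <= b ->
  {within `[a, b], continuous f} -> continuous (f \o clamp a b).
Proof.
move=> ab /subspace_continuousP cf u.
have := cf (clamp a b u) (clamp_itv u ab).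
apply: cvg_comp => A /=; rewrite /within/= => /(clamp_continuous (a := a) (b := b)).
rewrite /= !nbhs_simpl /=; apply: filterS => v; apply.
exact: clamp_itv.
Qed.

(** Up to the positive denominator, the left side is the harmonic point minus [z]. The right side
    shows that it lies on the same side of [z] as [c] and [x]. *)
Lemma harmonic_point_sub (c x t z : R) :
  c * x - z * (t * c + (1 - t) * x) = t * c * (x - z) + (1 - t) * x * (c - z).
Proof. by ring. Qed.

Lemma harmonic_point_itv (a b c x t : R) : 0 < a -> c \in `[a, b] ->
  x \in `[a, b] -> t \in `[0, 1] ->
  c * x / (t * c + (1 - t) * x) \in `[a, b].
Proof.
rewrite !in_itv/= => a0 /andP[ac cb] /andP[ax xb] t01.
have c0 : 0 < c by exact: lt_le_trans a0 _.
have x0 : 0 < x by exact: lt_le_trans a0 _.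
have A0 : 0 < t * c + (1 - t) * x by apply: segment_combo_gt0; rewrite ?in_itv.
move: t01 => /andP[t0 t1].
have tc0 : 0 <= t * c by rewrite mulr_ge0// ltW.
have tx0 : 0 <= (1 - t) * x by rewrite mulr_ge0 ?subr_ge0// ltW.
rewrite ler_pdivlMr// ler_pdivrMr//; apply/andP; split.
- by rewrite -subr_ge0 harmonic_point_sub; apply: addr_ge0;
    apply: mulr_ge0; rewrite ?subr_ge0.
- by rewrite -subr_le0 harmonic_point_sub -oppr_ge0 opprD -!mulrN;
    apply: addr_ge0; apply: mulr_ge0; rewrite ?opprB ?subr_ge0.
Qed.

(** Strictness puts the path inside the open interval, where [f] has a two-sided derivative. *)
Lemma harmonic_point_oo (a b c x t : R) : 0 < a -> c \in `[a, b] ->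
  x \in `[a, b] -> x != c -> t \in `]0, 1[ ->
  c * x / (t * c + (1 - t) * x) \in `]a, b[.
Proof.
move=> a0 cab xab xc t01.
have : t \in `[0, 1] by exact: subset_itv_oo_cc.
move=> /(harmonic_point_itv a0 cab xab); rewrite !in_itv/= !le_eqVlt.
move: cab xab t01; rewrite !in_itv/= => /andP[ac cb] /andP[ax xb] /andP[t0 t1].
have c0 : 0 < c by exact: lt_le_trans a0 _.
have x0 : 0 < x by exact: lt_le_trans a0 _.
have A0 : t * c + (1 - t) * x != 0.
  by rewrite gt_eqF// addr_gt0// mulr_gt0// subr_gt0.
have tc0 : t * c != 0 by rewrite mulf_neq0 ?gt_eqF.
have tx0 : (1 - t) * x != 0 by rewrite mulf_neq0 ?gt_eqF// subr_gt0.
have tc : 0 <= t * c by rewrite mulr_ge0// ltW.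
have tx : 0 <= (1 - t) * x by rewrite mulr_ge0 ?subr_ge0// ltW.
have cxE z : (z == c * x / (t * c + (1 - t) * x)) =
    (t * c * (x - z) + (1 - t) * x * (c - z) == 0).
  by rewrite -harmonic_point_sub subr_eq0 eq_sym -(inj_eq (mulIf A0)) divfK.
(* Two terms of the same sign add up to 0 only if both vanish, which would force [x = z = c]. *)
have nz z : z <= x /\ z <= c \/ x <= z /\ c <= z ->
    (z == c * x / (t * c + (1 - t) * x)) = false.
  move=> hz; rewrite cxE; apply/negbTE/negP.
  have -> : (t * c * (x - z) + (1 - t) * x * (c - z) == 0) =
      (t * c * (x - z) == 0) && ((1 - t) * x * (c - z) == 0).
    case: hz => [[zx zc]|[zx zc]]; last first.
      by rewrite naddr_eq0//; apply: mulr_ge0_le0; rewrite ?subr_le0.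
    by rewrite paddr_eq0//; apply: mulr_ge0; rewrite ?subr_ge0.
  rewrite (mulf_eq0 (t * c)) (mulf_eq0 ((1 - t) * x)) (negPf tc0) (negPf tx0)/=.
  rewrite !subr_eq0.
  by move=> /andP[/eqP xz /eqP cz]; rewrite xz cz eqxx in xc.
rewrite [_ / _ == b]eq_sym !nz//; [by right|by left].
Qed.

(** * The functions lambda_i as kernel integrals *)

Lemma lambda1E (a x s q : R) : 0 <= s -> 0 < a -> 0 < x ->
  lambda1 a x s q 1 =
  \int[mu]_(t in `[0, 1]) euler_kernel (s + 1) 0 (- (2 * q)) a x t.
Proof.
move=> s0 a0 x0; rewrite /lambda1.
have -> : 1 + s + 2 = (1 + s + 1) + 1 :> R by ring.
have g1 : 1 <= 1 + s + 1 by lra.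
rewrite (euler_beta_hypergeometric2F1 (2 * q) g1 (lexx 1) x0 a0).
by rewrite addrK subrr (addrC 1 s).
Qed.

Lemma lambda2E (a x s q : R) : 0 <= s -> 0 < a -> 0 < x ->
  lambda2 a x s q 1 =
  \int[mu]_(t in `[0, 1]) euler_kernel 1 s (- (2 * q)) a x t.
Proof.
move=> s0 a0 x0; rewrite /lambda2.
have -> : 1 + s + 2 = (1 + 1) + (s + 1) :> R by ring.
have g1 : (1 : R) <= 1 + 1 by lra.
have h1 : 1 <= s + 1 by lra.
rewrite (euler_beta_hypergeometric2F1 (2 * q) g1 h1 x0 a0).
by rewrite !addrK.
Qed.

(** The Euler integral comes with exponents 0 and [s + 1] and the endpoints in the order [x], [b];
    reflection brings it to the form of [lambda1] with [b] for [a]. *)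
Lemma lambda3E (b x s q : R) : 0 <= s -> 0 < b -> 0 < x ->
  lambda3 b x s q 1 =
  \int[mu]_(t in `[0, 1]) euler_kernel (s + 1) 0 (- (2 * q)) b x t.
Proof.
move=> s0 b0 x0; rewrite /lambda3.
have -> : 1 + s + 2 = 1 + (1 + s + 1) :> R by ring.
have h1 : 1 <= 1 + s + 1 by lra.
rewrite (euler_beta_hypergeometric2F1 (2 * q) (lexx 1) h1 b0 x0).
rewrite addrK subrr (addrC 1 s).
have s1 : 0 <= s + 1 by lra.
by rewrite (Rintegral_euler_kernel_onem _ (lexx 0) s1 x0 b0).
Qed.

Lemma lambda4E (b x s q : R) : 0 <= s -> 0 < b -> 0 < x ->
  lambda4 b x s q 1 =
  \int[mu]_(t in `[0, 1]) euler_kernel 1 s (- (2 * q)) b x t.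
Proof.
move=> s0 b0 x0; rewrite /lambda4.
have -> : 1 + s + 2 = (s + 1) + (1 + 1) :> R by ring.
have g1 : 1 <= s + 1 by lra.
have h1 : (1 : R) <= 1 + 1 by lra.
rewrite (euler_beta_hypergeometric2F1 (2 * q) g1 h1 b0 x0) !addrK.
by rewrite (Rintegral_euler_kernel_onem _ s0 ler01 x0 b0).
Qed.

End harmonic_points.

(** * The inequality, from the estimates at both endpoints *)

Local Notation mu := lebesgue_measure.

Theorem theorem5 (R : realType) (s : R) (hs : 0 < s <= 1)
    (I : set R) (I_itv : is_interval I) (I_pos : forall u, I u -> 0 < u)
    (f : R -> R) (f_diff : forall u, I° u -> derivable f u 1)
    (a b : R) (Ia : I a) (Ib : I b) (ab : a < b)
    (f_diff_ab : forall u, u \in `[a, b] -> derivable_within I f u)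
    (f'_int : (@lebesgue_measure R).-integrable `[a, b]
                (fun u => (derive_within I f u)%:E))
    (q : R) (hq : 1 <= q)
    (f'_conv : harmonically_s_convex s `[a, b]
                 (fun u => `|derive_within I f u| `^ q)) :
  forall x : R, x \in `[a, b] ->
    `|f x - a * b / (b - a) *
        \int[@lebesgue_measure R]_(u in `[a, b]) (f u / u ^+ 2)| <=
    a * b / (b - a) * (1 / 2) `^ (1 - 1 / q) *
    ((x - a) ^+ 2 *
       (lambda1 a x s q 1 * `|derive_within I f x| `^ q +
        lambda2 a x s q 1 * `|derive_within I f a| `^ q) `^ (1 / q) +
     (b - x) ^+ 2 *
       (lambda3 b x s q 1 * `|derive_within I f x| `^ q +
        lambda4 b x s q 1 * `|derive_within I f b| `^ q) `^ (1 / q)).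
Proof.
move=> x xab.
have [s0 s1] : 0 <= s /\ s <= 1 by case/andP: hs => /ltW.
have ab' := ltW ab.
have a0 := I_pos _ Ia; have b0 := I_pos _ Ib.
have aab : a \in `[a, b] by rewrite in_itv/= lexx.
have bab : b \in `[a, b] by rewrite in_itv/= lexx ab'.
have abI : `[a, b] `<=` I.
  by move=> u; rewrite /= in_itv/= => /I_itv; exact.
have ab_gt0 u : u \in `[a, b] -> 0 < u.
  by move=> uab; apply: I_pos; exact: abI.
have abI0 u : u \in `]a, b[ -> I° u.
  move=> uab; apply: filterS (near_in_itvoo uab) => v vab.
  by apply: abI; exact: subset_itv_oo_cc.
have x0 := ab_gt0 _ xab.
pose df := derive_within I f.
pose f1 := f \o clamp a b.
have f1E u : u \in `[a, b] -> f1 u = f u by move=> uab; rewrite /f1/= clamp_id.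
have cf1 : continuous f1.
  apply: continuous_clamp_comp => //; apply/subspace_continuousP => u uab.
  move=> B fB.
  have Bf : \forall v \near u, I v -> B (f v).
    exact: (derivable_within_cvg (f_diff_ab _ uab) fB).
  suff : \forall v \near u, v \in `[a, b] -> B (f v) by [].
  by apply: filterS Bf => v Bv vab; apply: Bv; exact: abI.
have df1 u : u \in `]a, b[ -> is_derive u 1 f1 (df u).
  move=> uab; have Iu := abI0 _ uab.
  apply: (@near_eq_is_derive _ _ _ f).
    apply: filterS (near_in_itvoo uab) => v vab.
    by rewrite f1E//; exact: subset_itv_oo_cc.
  rewrite /df derive_within_interior// derive1E.
  by apply: DeriveDef => //; exact: f_diff.
(* Clamping the denominator too keeps it away from 0, so [h] is continuous on the whole line. *)
pose h (u : R) := f1 u / clamp a b u ^+ 2.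
have ch : continuous h.
  move=> u; have cl0 : clamp a b u != 0 by rewrite gt_eqF// ab_gt0// clamp_itv.
  apply: cvgM; first exact: cf1.
  apply: cvgV; first by rewrite expf_neq0.
  by apply: cvgM; exact: clamp_continuous.
have ih u v : mu.-integrable `[u, v] (EFin \o h).
  by apply: within_continuous_integrable; exact: continuous_subspaceT.
(* Starting at [a - 1] makes every point of [a, b], endpoints included, interior to the domain of
   integration [a - 1, b + 1]. *)
pose P (u : R) := \int[mu]_(t in `[a - 1, u]) h t.
have dP (u : R) : u \in `[a, b] -> is_derive u 1 P (h u).
  rewrite in_itv/= => /andP[au ub].
  have ub1 : u < b + 1 by rewrite (le_lt_trans ub)// ltrDl.
  have au1 : a - 1 < u by rewrite (lt_le_trans _ au)// ltrBlDr ltrDl.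
  have [dPu PE] := continuous_FTC1_closed ub1 (ih _ _) au1 (ch u).
  by apply: DeriveDef; [exact: dPu|rewrite -derive1E; exact: PE].
have PbPa : P b - P a = \int[mu]_(u in `[a, b]) (f u / u ^+ 2).
  rewrite /P Rintegral_itvB//; last by rewrite bnd_simp lerBlDr ler_wpDr.
  rewrite Rintegral_itv_obnd_cbnd; last first.
    by apply: integrableS (ih a b) => //; exact: subset_itv_oc_cc.
  by apply: eq_Rintegral => u; rewrite inE/= => uab; rewrite /h f1E// clamp_id.
have est (c : R) : c \in `[a, b] ->
    `|(c^-1 - x^-1) * f x - (P x - P c)| <=
    (x - c) ^+ 2 * ((1 / 2) `^ (1 - 1 / q) *
    ((\int[mu]_(t in `[0, 1]) euler_kernel (s + 1) 0 (- (2 * q)) c x t) * `|df x| `^ q +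
     (\int[mu]_(t in `[0, 1]) euler_kernel 1 s (- (2 * q)) c x t) * `|df c| `^ q) `^ (1 / q)).
  (* If [x = c] the path is constant and both sides are 0. *)
  move=> cab; have [->|xc] := eqVneq x c.
    by rewrite !subrr mul0r expr0n mul0r subrr normr0.
  have c0 := ab_gt0 _ cab.
  rewrite -(f1E _ xab).
  have m0 u : 0 <= `|df u| `^ q by exact: powR_ge0.
  apply (@harmonic_endpoint_estimate R f1 df P c x s q _ _
    c0 x0 xc s0 hq (m0 x) (m0 c)).
  - by move=> t t01; exact: cf1.
  - move=> t t01; apply: differentiable_continuous; apply/derivable1_diffP.
    by have [] := dP _ (harmonic_point_itv a0 cab xab t01).
  - by move=> t t01; apply: df1; exact: harmonic_point_oo.
  - move=> t t01; have phiab := harmonic_point_itv a0 cab xab (subset_itv_oo_cc t01).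
    by have := dP _ phiab; rewrite {1}/h clamp_id.
  - move=> t; rewrite in_itv/= => /andP[t0 t1].
    by apply: f'_conv => //; rewrite !ltW.
rewrite -PbPa lambda1E// lambda2E// lambda3E// lambda4E//.
(* The terms with [x^-1] and [P x] cancel, and [a^-1 - b^-1] is the inverse of [a * b / (b - a)]. *)
have -> : f x - a * b / (b - a) * (P b - P a) = a * b / (b - a) *
    (((a^-1 - x^-1) * f x - (P x - P a)) - ((b^-1 - x^-1) * f x - (P x - P b))).
  by field; rewrite subr_eq0 !gt_eqF.
rewrite normrM ger0_norm; last by rewrite divr_ge0 ?mulr_ge0 ?subr_ge0// ltW.
rewrite -[X in _ <= X]mulrA ler_wpM2l//.
  by rewrite divr_ge0 ?mulr_ge0 ?subr_ge0// ltW.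
apply: (le_trans (ler_normB _ _)); rewrite mulrDr; apply: lerD.
- by rewrite mulrCA; exact: est.
- by rewrite mulrCA (_ : (b - x) ^+ 2 = (x - b) ^+ 2); [exact: est|ring].
Qed.
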